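(* Let $f\in\mathrm{Sym}\,\mathbb{R}\langle\underline{X}\rangle$, and let $\mathfrak{g}=\{g_0,\dots,g_m\}$ (with $g_0=1$) and $\mathfrak{h}=\{h_1,\dots,h_\ell\}$ be finite subsets of $\mathrm{Sym}\,\mathbb{R}\langle\underline{X}\rangle$. If $1-\sum_{j=1}^nX_j^2\in\mathfrak{g}$, then $\mathbb{R}^{>0}\subset Q_k^\circ(\mathfrak{g})$ for every integer $k\ge k_{\min}$ (every positive real constant, viewed as a constant polynomial, belongs to $Q_k^\circ(\mathfrak{g})$), and therefore the eigenvalue minimization problem and the trace minimization problem with data $(f,\mathfrak{g},\mathfrak{h})$ have the constant trace property (CTP).
   Context: $\mathbb{R}\langle\underline{X}\rangle$ is the free algebra of polynomials in noncommuting letters $\underline{X}=(X_1,\dots,X_n)$, with the involution $*$ fixing $\mathbb{R}$ and each $X_i$ and reversing words; $\mathrm{Sym}\,\mathbb{R}\langle\underline{X}\rangle$ is the set of $p$ with $p^*=p$. $\mathbf{W}_d$ denotes both the set of all words of length at most $d$ (including the empty word $1$) and the column vector of these words in graded lexicographic order, of length $\mathbf{s}(d)=\sum_{i=0}^d n^i$; $\mathbf{W}_d^*$ is the row vector with entries $w^*$. For a polynomial $q$, $\lceil q\rceil:=\lceil\deg(q)/2\rceil$, $k_q:=k-\lceil q\rceil$. $k_{\min}:=\max\{\lceil f\rceil,\lceil g_i\rceil,\lceil h_j\rceil:1\le i\le m,1\le j\le\ell\}$. For $k\ge k_{\min}$, $$Q_k^\circ(\mathfrak{g}):=\Big\{\sum_{i=0}^m\mathrm{Tr}\big(\mathbf{G}_i\mathbf{W}_{k_{g_i}}g_i\mathbf{W}_{k_{g_i}}^*\big):\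 \mathbf{G}_i\succ0\Big\},$$ where $\mathbf{G}_i$ ranges over real symmetric positive definite matrices of size $\mathbf{s}(k_{g_i})$; here $\mathrm{Tr}(\mathbf{G}\mathbf{W}_d\,g\,\mathbf{W}_d^* )=\sum_{u,v\in\mathbf{W}_d}\mathbf{G}_{u,v}\,v\,g\,u^*$. Riesz functional: for $\mathbf{y}=(y_w)_{w\in\mathbf{W}_{2k}}$ real with $y_w=y_{w^*}$, $L_{\mathbf{y}}(\sum_w q_ww)=\sum_wq_wy_w$. $\mathbf{M}_k(\mathbf{y})$ has entries $L_{\mathbf{y}}(u^*v)$, $u,v\in\mathbf{W}_k$; for symmetric $q$, $\mathbf{M}_{k_q}(q\mathbf{y})$ has entries $L_{\mathbf{y}}(u^*qv)$, $u,v\in\mathbf{W}_{k_q}$. $\mathbf{D}_k(\mathbf{y}):=\mathrm{diag}(\mathbf{M}_k(\mathbf{y}),\mathbf{M}_{k_{g_1}}(g_1\mathbf{y}),\dots,\mathbf{M}_{k_{g_m}}(g_m\mathbf{y}))$. $\mathcal{S}^{(k)}$ is the set of block diagonal real symmetric matrices $\mathrm{diag}(\mathbf{Y}_0,\dots,\mathbf{Y}_m)$ with $\mathbf{Y}_i$ symmetric of size $\mathbf{s}(k_{g_i})$, and $\mathcal{S}^{(k)}_{++}$ its positive definite elements. The eigenvalue minimization problem is $\inf\{\mathbf{v}^*f(\underline{A})\mathbf{v}\}$ over unit vectors $\mathbf{v}$ and tuples $\underline{A}$ of bounded self-adjoint Hilbert space operators with $g(\underline{A})\succeq0$ for all $g\in\mathfrak{g}$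 and $h(\underline{A})=0$ for all $h\in\mathfrak{h}$; the trace minimization problem minimizes the normalized trace of $f(\underline{A})$ over tuples of real symmetric matrices satisfying the same constraints. CTP (the same condition on the data for both problems): for every integer $k\ge k_{\min}$ there exist $a_k>0$ and $\mathbf{P}_k\in\mathcal{S}^{(k)}_{++}$ such that for all $\mathbf{y}$ indexed by $\mathbf{W}_{2k}$ with $y_w=y_{w^*}$: if $\mathbf{M}_{k_{h_j}}(h_j\mathbf{y})=0$ for all $j=1,\dots,\ell$ and $y_1=1$, then $\mathrm{Tr}(\mathbf{P}_k^*\mathbf{D}_k(\mathbf{y})\mathbf{P}_k)=a_k$. *)

(* Defs.v *)
From HB Require Import structures.
From mathcomp Require Import all_boot all_order all_algebra.
From mathcomp Require Import finmap reals.
From mathcomp.multinomials Require Import monalg.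

Set Implicit Arguments.
Unset Strict Implicit.
Unset Printing Implicit Defensive.

Import Order.TTheory GRing.Theory Num.Theory.

Local Open Scope ring_scope.

Notation word n := {fmonom 'I_n}.
Notation ncpoly R n := {malg R[{fmonom 'I_n}]}.

Definition wstar (n : nat) (w : word n) : word n := FMonom (rev w).

Section FreeAlgebra.
Variables (R : realType) (n : nat).
Implicit Types (p q : ncpoly R n) (w : word n).

Definition ncX (i : 'I_n) : ncpoly R n := << fmu i >>.

Definition ncstar p : ncpoly R n :=
  \sum_(w <- msupp p) << p@_w *g wstar w >>.

Definition ncsym p : Prop := ncstar p = p.

(* mmeasure is 1 + degree, and 0 for the zero polynomial: with this convention
   the zero polynomial has degree 0. *)
Definition ncdeg p : nat := (mmeasure (@fdeg 'I_n) p).-1.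

Definition half_deg p : nat := uphalf (ncdeg p).

Definition korder (k : nat) p : nat := (k - half_deg p)%N.

End FreeAlgebra.

Section Words.
Variable n : nat.

(* Lexicographic order: the first letter is the most significant one. *)
Fixpoint words_of_length (d : nat) : seq (word n) :=
  if d is d'.+1 then
    [seq mmul (fmu i) w | i <- enum 'I_n, w <- words_of_length d']
  else [:: mone].

Definition words (d : nat) : seq (word n) :=
  flatten [seq words_of_length i | i <- iota 0 d.+1].

Definition nwords (d : nat) : nat := (\sum_(i < d.+1) n ^ i)%N.

Definition W (d : nat) (i : 'I_(nwords d)) : word n := nth mone (words d) i.

Lemma size_words_of_length d : size (words_of_length d) = (n ^ d)%N.
Proof.
by elim: d => //= d IHd; rewrite size_allpairs size_enum_ord IHd expnS.
Qed.

Lemma mem_words_of_length d (w : word n) :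
  (w \in words_of_length d) = (fdeg w == d).
Proof.
elim: d w => [|d IHd] w /=.
  by rewrite inE fdeg_eq0.
apply/allpairsP/eqP => [[[i v] /= [_ vd ->]]|].
  by rewrite fdegM fdegU; move: vd; rewrite IHd => /eqP ->.
case: w => -[//|i s] /= [sd].
exists (i, FMonom s); split; rewrite ?mem_enum //=.
  by rewrite IHd fdegE /= sd.
by apply/eqP; rewrite fmP fmM fmU.
Qed.

Lemma uniq_words_of_length d : uniq (words_of_length d).
Proof.
elim: d => //= d IHd; apply: allpairs_uniq; rewrite ?enum_uniq // => -[i v] [j w].
move=> _ _ /= /eqP; rewrite fmP !fmM !fmU /= => /eqP [-> vw].
by congr pair; apply/eqP; rewrite fmP vw.
Qed.

Lemma size_words d : size (words d) = nwords d.
Proof.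
rewrite /words size_flatten /shape -map_comp sumnE big_map /nwords.
rewrite -(big_mkord xpredT (fun i => (n ^ i)%N)) /index_iota subn0.
by apply: eq_bigr => i _ /=; rewrite size_words_of_length.
Qed.

Lemma mem_words d (w : word n) : (w \in words d) = (fdeg w <= d)%N.
Proof.
apply/flattenP/idP => [[s /mapP[i + ->]]|wd].
  by rewrite mem_iota mem_words_of_length => id /eqP ->.
exists (words_of_length (fdeg w)); last by rewrite mem_words_of_length.
by apply: map_f; rewrite mem_iota.
Qed.

Lemma uniq_words d : uniq (words d).
Proof.
rewrite /words; elim: (iota 0 d.+1) (iota_uniq 0 d.+1) => //= i s IHs.
case/andP=> is_ us; rewrite cat_uniq uniq_words_of_length IHs // andbT /=.
apply/hasPn => w /flattenP[_ /mapP[j js ->]]; rewrite !mem_words_of_length.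
by move/eqP=> ->; apply: contraNneq is_ => <-.
Qed.

End Words.

Section MatrixNotions.
Variable R : realType.

Definition posdef (d : nat) (A : 'M[R]_d) : Prop :=
  A^T = A /\ forall x : 'cV[R]_d, x != 0 -> 0 < (x^T *m A *m x) 0 0.

End MatrixNotions.

Section Hierarchy.
Variables (R : realType) (n : nat).

Definition trGW (d : nat) (G : 'M[R]_(nwords n d)) (g : ncpoly R n) :
    ncpoly R n :=
  \sum_i \sum_j G i j *: (<< W j >> * g * ncstar << W i >>).

Definition Qint (m : nat) (g : 'I_m.+1 -> ncpoly R n) (k : nat)
    (p : ncpoly R n) : Prop :=
  exists G : forall i : 'I_m.+1, 'M[R]_(nwords n (korder k (g i))),
    (forall i, posdef (G i)) /\ p = \sum_i trGW (G i) (g i).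

(* A family y indexed by the words of length at most 2k is represented by a
   function on all words; only its values on these words matter below, because
   riesz y is only applied to polynomials of degree at most 2k. *)
Definition riesz (y : word n -> R) (q : ncpoly R n) : R :=
  \sum_(w <- msupp q) q@_w * y w.

Definition sym_upto (d : nat) (y : word n -> R) : Prop :=
  forall w : word n, (fdeg w <= d)%N -> y (wstar w) = y w.

Definition locmx (d : nat) (q : ncpoly R n) (y : word n -> R) :
    'M[R]_(nwords n d) :=
  \matrix_(i, j) riesz y (ncstar << W i >> * q * << W j >>).

(* When g ord0 = 1, the block of index 0 is the moment matrix of order k. *)
Definition Dmx (m : nat) (g : 'I_m.+1 -> ncpoly R n) (k : nat)
    (y : word n -> R) :
    'M[R]_(\sum_(i < m.+1) nwords n (korder k (g i))) :=
  \mxdiag_(i < m.+1) locmx (korder k (g i)) (g i) y.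

Definition Sblock (m : nat) (g : 'I_m.+1 -> ncpoly R n) (k : nat)
    (P : 'M[R]_(\sum_(i < m.+1) nwords n (korder k (g i)))) : Prop :=
  exists Y : forall i : 'I_m.+1, 'M[R]_(nwords n (korder k (g i))),
    (forall i, (Y i)^T = Y i) /\ P = \mxdiag_(i < m.+1) Y i.

Definition kmin (m l : nat) (f : ncpoly R n) (g : 'I_m.+1 -> ncpoly R n)
    (h : 'I_l -> ncpoly R n) : nat :=
  maxn (half_deg f)
    (maxn (\max_(i < m.+1 | (0 < i)%N) half_deg (g i))
          (\max_(j < l) half_deg (h j))).

(* The constant trace property is a condition on the data (f, g, h) alone: it
   is the same for the eigenvalue and for the trace minimization problem. *)
Definition CTP (m l : nat) (f : ncpoly R n) (g : 'I_m.+1 -> ncpoly R n)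
    (h : 'I_l -> ncpoly R n) : Prop :=
  forall k : nat, (kmin f g h <= k)%N ->
  exists (a : R) (P : 'M[R]_(\sum_(i < m.+1) nwords n (korder k (g i)))),
    [/\ 0 < a, Sblock P, posdef P &
      forall y : word n -> R,
        sym_upto k.*2 y ->
        (forall j, locmx (korder k (h j)) (h j) y = 0) ->
        y mone = 1 ->
        \tr (P^T *m Dmx g k y *m P) = a].

End Hierarchy.

(* Main.v *)
From HB Require Import structures.
Require Import Defs.
From mathcomp Require Import all_boot all_order all_algebra.
From mathcomp Require Import finmap reals.
From mathcomp Require Import spectral sesquilinear complex zify.
From mathcomp.multinomials Require Import monalg.

Set Implicit Arguments.
Unset Strict Implicit.
Unset Printing Implicit Defensive.

Import Order.TTheory GRing.Theory Num.Theory.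

Local Open Scope ring_scope.

(** Everything rests on one identity.  Write X for the letters and let S_l be
    the sum of w w^* over the words w of length l, so that S_0 = 1.  Inserting
    the ball polynomial between w and w^* and summing over the words of length
    l gives S_l - S_(l+1), because w X_j runs through the words of length l+1.
    Summation by parts then yields

      S_0 + ... + S_k + sum_(l < k) (k - l) (S_l - S_(l+1)) = k + 1,

    a weighted sum-of-squares certificate of a positive constant: the weight of
    1 has the identity as Gram matrix, the weight of the ball polynomial has a
    nonnegative diagonal Gram matrix, all other weights are 0
    ([ball_certificate]).

    This certificate is moved into the interior by a perturbation.  Adding a
    multiple e of the identity to the Gram matrix of every g_i with i > 0 adds
    e p to the sum, for a fixed symmetric polynomial p of degree at most 2k.
    Such a p has a symmetric Gram matrix B with respect to g_0 = 1
    ([gram_sym]), so replacing the identity by 1 - e B in the block of g_0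
    compensates the change, and 1 - e B is positive definite for small e
    ([posdef_perturb1]).  Hence k + 1, and by scaling every positive constant,
    lies in the interior of the quadratic module ([Qint_ball]).

    The constant trace property is the dual form of this membership.  If G is
    positive definite, and P is the positive definite square root of G with
    rows and columns permuted by word reversal, then Tr (P M(g y) P) is the
    value of the Riesz functional on Tr (G W g W^* ) ([trace_duality]).
    Summing over the blocks of a certificate of the constant 1 gives
    Tr (P D(y) P) = y_1 = 1.

    The square root has to be symmetric, not just a Cholesky factor; it is
    obtained as a polynomial in the matrix, interpolating the square root on
    the spectrum ([posdef_sqrt]). *)

(** * Positive definite matrices and their square roots *)

Lemma interpolation (F : fieldType) (phi : F -> F) (s : seq F) :
  exists q : {poly F}, forall x, x \in s -> q.[x] = phi x.
Proof.
elim: s => [|a s [q qs]]; first by exists 0.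
have [a_s|a_s] := boolP (a \in s).
  by exists q => x; rewrite in_cons => /predU1P[->|]; apply: qs.
pose r := \prod_(b <- s) ('X - b%:P).
have ra0 : r.[a] != 0 by rewrite -[_ == 0]/(root _ _) root_prod_XsubC.
exists (q + ((phi a - q.[a]) / r.[a])%:P * r) => x.
rewrite !hornerE in_cons => /predU1P[->|xs]; first by rewrite mulfVK // subrKC.
have -> : r.[x] = 0 by apply/rootP; rewrite root_prod_XsubC.
by rewrite mulr0 addr0 qs.
Qed.

Section PositiveSquareRoot.
Variable R : realType.

Lemma sqnorm_ge0 n (x : 'cV[R]_n) : 0 <= (x^T *m x) 0 0.
Proof. by rewrite mxE sumr_ge0 // => i _; rewrite mxE -expr2 sqr_ge0. Qed.

Lemma sqnorm_gt0 n (x : 'cV[R]_n) : x != 0 -> 0 < (x^T *m x) 0 0.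
Proof.
move=> x0; have xge0 i : 0 <= x^T 0 i * x i 0 by rewrite mxE -expr2 sqr_ge0.
rewrite mxE lt_def sumr_ge0 // andbT; apply: contraNneq x0 => /psumr_eq0P xx.
apply/eqP/matrixP=> i j; rewrite ord1 mxE; have := xx (fun k _ => xge0 k) i isT.
by rewrite mxE => /eqP; rewrite mulf_eq0 orbb => /eqP.
Qed.

Lemma eigenvalue_posdef n (A : 'M[R]_n) a : posdef A -> eigenvalue A a -> 0 < a.
Proof.
move=> [_ Apos] /eigenvalueP[v vA v0].
have vT0 : v^T != 0 by rewrite trmx_eq0.
have := Apos _ vT0; rewrite trmxK vA -scalemxAl mxE.
by rewrite -[v in _ * (v *m _) _ _]trmxK pmulr_lgt0 // sqnorm_gt0.
Qed.

Lemma posdef_sqr n (S : 'M[R]_n) : S^T = S -> S \in unitmx -> posdef (S *m S).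
Proof.
move=> Ssym Su; split=> [|x x0]; first by rewrite trmx_mul Ssym.
rewrite !mulmxA -mulmxA -{1}Ssym -trmx_mul sqnorm_gt0 //.
apply: contraNneq x0 => /(congr1 (mulmx (invmx S))).
by rewrite mulKmx // mulmx0 => ->.
Qed.

Lemma trmx_horner n (A : 'M[R]_n.+1) (q : {poly R}) :
  A^T = A -> (horner_mx A q)^T = horner_mx A q.
Proof.
move=> Asym; elim/poly_ind: q => [|q c IHq]; first by rewrite rmorph0 trmx0.
rewrite rmorphD rmorphM /= horner_mx_X horner_mx_C linearD /= trmx_mul IHq Asym.
by rewrite tr_scalar_mx comm_mx_horner.
Qed.

Local Notation toC := (real_complex R).

(** A real symmetric matrix is Hermitian over R[i], where it can be
    diagonalized, with real spectrum. *)
Lemma real_spectral n (A : 'M[R]_n) : A^T = A ->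
  exists P : 'M[R[i]]_n, exists2 d : 'rV[R]_n,
    P \in unitmx & map_mx toC A = invmx P *m diag_mx (map_mx toC d) *m P.
Proof.
move=> Asym.
have Aherm : map_mx toC A \is hermsymmx.
  apply: realsym_hermsym.
    by apply/is_hermitianmxP; rewrite expr0 scale1r map_mx_id // map_trmx Asym.
  by apply/mxOverP => i j; rewrite mxE; apply/complex_realP; exists (A i j).
have /orthomx_spectralP A_eq := hermitian_normalmx Aherm.
have dreal := hermitian_spectral_diag_real Aherm.
pose d := map_mx (@complex.Re R) (spectral_diag (map_mx toC A)).
have dE : map_mx toC d = spectral_diag (map_mx toC A).
  by apply/matrixP=> i j; rewrite !mxE RRe_real //; apply: (mxOverP dreal).
exists (spectralmx (map_mx toC A)), d; first exact: spectral_unit.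
by rewrite dE.
Qed.

(** If q interpolates the fourth root on the spectrum of A, then S = q(A) is
    symmetric and S^4 = A.  The fourth root, rather than the square root, makes
    the square root of A itself a square S^2 of an invertible symmetric matrix,
    hence positive definite. *)
Lemma posdef_sqrt n (A : 'M[R]_n) : posdef A ->
  exists2 P : 'M[R]_n, posdef P & P *m P = A.
Proof.
case: n A => [|n] A Apos.
  by exists A => //; rewrite [LHS]flatmx0 [RHS]flatmx0.
have [Asym _] := Apos; have [P [d Pu A_eq]] := real_spectral Asym.
have dpos i : 0 < d 0 i.
  (* d 0 i is an eigenvalue of A over R[i], so a root of the characteristic
     polynomial, which has real coefficients: it is an eigenvalue over R. *)
  apply: (eigenvalue_posdef Apos); rewrite eigenvalue_root_char.
  rewrite -(fmorph_root toC) map_char_poly -eigenvalue_root_char.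
  apply/eigenvalueP; exists (row i P); last first.
    apply: contraTneq Pu => Pi0; rewrite -row_free_unit -kermx_eq0.
    apply/negP => /eqP ker0.
    have /eqP : (delta_mx 0 i : 'rV_n.+1) *m P = 0 by rewrite -rowE.
    rewrite -sub_kermx ker0 submx0 => /eqP /matrixP /(_ 0 i).
    by rewrite !mxE !eqxx => /eqP; rewrite oner_eq0.
  rewrite A_eq !mulmxA -row_mul mulmxV // -row_mul mul1mx row_diag_mx.
  by rewrite -scalemxAl -rowE mxE.
have [q q_d] := interpolation (fun x => Num.sqrt (Num.sqrt x))
  [seq d 0 i | i <- enum 'I_n.+1].
have q4 : horner_mx A (q ^+ 4) = A.
  apply: (map_mx_inj (f := toC)).
  have qd : map_mx (horner (map_poly toC (q ^+ 4))) (map_mx toC d) =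
      map_mx toC d.
    apply/matrixP=> i j; rewrite ord1 !mxE horner_map /= hornerE.
    rewrite q_d ?map_f ?mem_enum // (exprM _ 2 2) !sqr_sqrtr ?sqrtr_ge0 //.
    exact: ltW.
  rewrite [LHS]map_horner_mx [in LHS]A_eq horner_mx_uconjC // horner_mx_diag.
  by rewrite qd -A_eq.
pose S := horner_mx A q.
have S4 : S *m S *m (S *m S) = A.
  by rewrite -[RHS]q4 !mulmxE -!rmorphM /= -!expr2 -exprM.
have Su : S \in unitmx.
  suff : A \in unitmx by rewrite -S4 -!mulmxA unitmx_mul => /andP[].
  rewrite -row_free_unit -kermx_eq0; apply: contraT.
  move=> /rowV0Pn[v /sub_kermxP vA v0].
  suff : 0 < 0 :> R by rewrite ltxx.
  apply: (eigenvalue_posdef Apos); apply/eigenvalueP; exists v => //.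
  by rewrite vA scale0r.
by exists (S *m S) => //; apply: posdef_sqr; rewrite ?trmx_horner.
Qed.
End PositiveSquareRoot.

Section PositiveDefinite.
Variable R : realType.

Lemma posdef1 n : posdef (1%:M : 'M[R]_n).
Proof. by split=> [|x x0]; rewrite ?trmx1 // mulmx1 sqnorm_gt0. Qed.

Lemma posdefZ n c (A : 'M[R]_n) : 0 < c -> posdef A -> posdef (c *: A).
Proof.
move=> c0 [Asym Apos]; split=> [|x x0]; first by rewrite linearZ /= Asym.
by rewrite -scalemxAr -scalemxAl mxE mulr_gt0 ?Apos.
Qed.

Lemma posdefD_diag n (A : 'M[R]_n) (D : 'rV[R]_n) :
  posdef A -> (forall i, 0 <= D 0 i) -> posdef (A + diag_mx D).
Proof.
move=> [Asym Apos] D0; split=> [|x x0].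
  by rewrite linearD /= Asym tr_diag_mx.
rewrite mulmxDr mulmxDl mxE ltr_wpDr ?Apos // mul_mx_diag.
rewrite mxE sumr_ge0 // => i _.
by rewrite !mxE mulrAC mulr_ge0 // -expr2 sqr_ge0.
Qed.

Lemma quad_form_bound n (B : 'M[R]_n) :
  exists2 C, 0 < C & forall x : 'cV[R]_n,
    (x^T *m B *m x) 0 0 <= C * (x^T *m x) 0 0.
Proof.
pose C := \sum_i \sum_j `|B i j|.
have C0 : 0 <= C by apply: sumr_ge0 => i _; apply: sumr_ge0.
exists (C + 1) => [|x]; first by rewrite ltr_wpDl.
have xx i : x i 0 ^+ 2 <= (x^T *m x) 0 0.
  rewrite mxE (bigD1 i) //= mxE -expr2 lerDl sumr_ge0 // => j _.
  by rewrite mxE -expr2 sqr_ge0.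
have xij i j : `|x i 0 * x j 0| <= (x^T *m x) 0 0.
  rewrite normrM; have [ij|/ltW ji] := leP `|x i 0| `|x j 0|.
    apply: le_trans (xx j).
    by rewrite -(real_normK (num_real (x j 0))) expr2 ler_wpM2r.
  apply: le_trans (xx i).
  by rewrite -(real_normK (num_real (x i 0))) expr2 ler_wpM2l.
apply: (@le_trans _ _ (C * (x^T *m x) 0 0)); last first.
  by rewrite ler_wpM2r ?sqnorm_ge0 // lerDl.
set N := (x^T *m x) 0 0 in xij *.
rewrite -mulmxA mxE /C mulr_suml ler_sum // => i _.
rewrite !mxE mulr_sumr mulr_suml ler_sum // => j _.
rewrite mulrCA; apply: (le_trans (ler_norm _)).
by rewrite normrM ler_wpM2l.
Qed.

Lemma posdef_perturb1 n (B : 'M[R]_n) : B^T = B ->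
  exists2 e, 0 < e & posdef (1%:M - e *: B).
Proof.
move=> Bsym; have [C C0 Cx] := quad_form_bound B.
have e0 : 0 < (C + 1)^-1 by rewrite invr_gt0 ltr_wpDr.
exists (C + 1)^-1 => //; split=> [|x x0].
  by rewrite linearB linearZ /= trmx1 Bsym.
rewrite mulmxBr mulmxBl mulmx1 -scalemxAr -scalemxAl.
rewrite [ltRHS]mxE [X in _ + X]mxE [X in - X]mxE subr_gt0.
apply: le_lt_trans (ler_wpM2l (ltW e0) (Cx x)) _; rewrite mulrA mulrC.
by rewrite gtr_pMr ?sqnorm_gt0 // mulrC ltr_pdivrMr ?mul1r ?ltrDl // ltr_wpDr.
Qed.
End PositiveDefinite.

Section BlockDiagonal.
Variable R : realType.

Lemma posdef_mxdiag (m : nat) (d : 'I_m -> nat) (P : forall i, 'M[R]_(d i)) :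
  (forall i, posdef (P i)) -> posdef (\mxdiag_i P i).
Proof.
move=> Ppos; split=> [|x x0].
  by rewrite tr_mxdiag; apply/eq_mxdiagP => i; have [-> _] := Ppos i.
rewrite -(submxcolK x) tr_mxcol mul_mxrow_mxdiag mul_mxrow_mxcol summxE.
have Pge0 i (z : 'cV[R]_(d i)) : 0 <= (z^T *m P i *m z) 0 0.
  have [->|z0] := eqVneq z 0; first by rewrite mulmx0 mxE.
  by have [_ Pi] := Ppos i; apply/ltW/Pi.
have [i xi0] : exists i, submxcol x i != 0.
  apply/existsP; apply: contraNT x0 => /existsPn x0.
  apply/eqP/mxcolP => i; rewrite submxcol0.
  by apply/eqP; have := x0 i; rewrite negbK.
rewrite (bigD1 i) //= ltr_pwDl ?sumr_ge0 //.
by have [_ Pi] := Ppos i; apply: Pi.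
Qed.

Lemma mul_mxdiag (m : nat) (d : 'I_m -> nat) (A B : forall i, 'M[R]_(d i)) :
  \mxdiag_i A i *m \mxdiag_i B i = \mxdiag_i (A i *m B i).
Proof.
rewrite [in X in _ *m X]/mxdiag mul_mxdiag_mxblock; apply/eq_mxblockP => i j.
by case: eqVneq => [<-|_]; rewrite ?conform_mx_id ?mulmx0.
Qed.

End BlockDiagonal.

(** * The involution of the free algebra *)

Section Involution.
Variables (R : realType) (n : nat).
Implicit Types (p q : ncpoly R n) (w : word n).

Lemma wstarK : involutive (@wstar n).
Proof. by move=> w; apply/eqP; rewrite fmP /= revK. Qed.

Lemma wstarM (u v : word n) : wstar (mmul u v) = mmul (wstar v) (wstar u).
Proof. by apply/eqP; rewrite fmP fmM /= fmM rev_cat. Qed.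

Lemma fdeg_wstar (w : word n) : fdeg (wstar w) = fdeg w.
Proof. by rewrite !fdegE size_rev. Qed.

Lemma mcoeff_ncstar p w : (ncstar p)@_w = p@_(wstar w).
Proof.
rewrite raddf_sum /=; under eq_bigr => u _ do rewrite mcoeffU.
have [wp|wp] := boolP (wstar w \in msupp p).
  rewrite (big_fsetD1 _ wp) /= wstarK eqxx big_seq big1 ?addr0 // => u.
  rewrite in_fsetD1 => /andP[uw _]; case: eqVneq => // uE.
  by rewrite -uE wstarK eqxx in uw.
rewrite (mcoeff_outdom wp) big_seq big1 // => u up; case: eqVneq => // uE.
by rewrite -uE wstarK up in wp.
Qed.

Lemma ncstarE p : ncstar p = \sum_(w <- msupp p) << p@_w *g wstar w >>.
Proof. by []. Qed.

Lemma ncstar_linear : linear (@ncstar R n).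
Proof.
move=> a p q; apply/malgP => w.
rewrite mcoeff_ncstar [in LHS]mcoeffD [in LHS]mcoeffZ.
rewrite [RHS]mcoeffD [in RHS]mcoeffZ.
by congr (_ * _ + _); apply/esym/mcoeff_ncstar.
Qed.

HB.instance Definition _ :=
  GRing.isLinear.Build R (ncpoly R n) (ncpoly R n) _ (@ncstar R n)
    ncstar_linear.

Lemma ncstarK : involutive (@ncstar R n).
Proof. by move=> p; apply/malgP => w; rewrite !mcoeff_ncstar wstarK. Qed.

Lemma ncstarU (c : R) w : ncstar << c *g w >> = << c *g wstar w >>.
Proof.
apply/malgP => u; rewrite mcoeff_ncstar !mcoeffU.
by rewrite (inv_eq wstarK) eq_sym (inv_eq wstarK) eq_sym.
Qed.

Lemma ncstar1 : ncstar 1 = 1 :> ncpoly R n.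
Proof.
rewrite -[1]/(<< _ >>) ncstarU; congr << _ *g _ >>.
by apply/eqP; rewrite fmP /= fm1.
Qed.

Lemma mulUU (a b : R) (u v : word n) :
  << a *g u >> * << b *g v >> = << a * b *g mmul u v >> :> ncpoly R n.
Proof. by rewrite malgM_def fgmulUU. Qed.

Lemma ncstarM p q : ncstar (p * q) = ncstar q * ncstar p.
Proof.
rewrite malgME raddf_sum /= [ncstar q]ncstarE [ncstar p]ncstarE.
rewrite big_distrlr exchange_big /=.
apply: eq_bigr => u _; rewrite raddf_sum /=; apply: eq_bigr => v _.
by rewrite ncstarU wstarM mulUU mulrC.
Qed.

Lemma ncstar_sandwich p q r :
  ncstar (p * ncstar q * ncstar r) = r * q * ncstar p.
Proof.
rewrite -[RHS]mulrA; apply: (etrans (ncstarM _ _)); congr (_ * _).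
  exact: ncstarK.
by apply: (etrans (ncstarM _ _)); congr (_ * _); apply: ncstarK.
Qed.
End Involution.

(** * Gram matrices *)

Section GramMatrices.
Variables (R : realType) (n : nat).
Implicit Types (p q : ncpoly R n) (w : word n).

Definition deg_le (d : nat) p : Prop :=
  forall w, w \in msupp p -> (fdeg w <= d)%N.

Lemma deg_le_sum d (I : Type) (r : seq I) (P : pred I) (F : I -> ncpoly R n) :
  (forall i, P i -> deg_le d (F i)) -> deg_le d (\sum_(i <- r | P i) F i).
Proof.
move=> Fd; elim/big_ind: _ => // [w|p q pd qd w].
  by rewrite msupp0.
by move/(fsubsetP (msuppD_le _ _)); rewrite in_fsetU => /orP[/pd|/qd].
Qed.

Lemma deg_leZ d (c : R) p : deg_le d p -> deg_le d (c *: p).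
Proof. by move=> pd w /(fsubsetP (msuppZ_le _ _))/pd. Qed.

Lemma deg_leM d e p q : deg_le d p -> deg_le e q -> deg_le (d + e) (p * q).
Proof.
move=> pd qe w /msuppM_le[u [v [up vq ->]]].
by rewrite fdegM leq_add ?pd ?qe.
Qed.

Lemma deg_leU (c : R) w : deg_le (fdeg w) << c *g w >>.
Proof. by move=> v /(fsubsetP msuppU_le); rewrite inE => /eqP->. Qed.

Lemma deg_le_ncdeg p : deg_le (ncdeg p) p.
Proof.
move=> w wp; rewrite -ltnS (leq_trans (mmeasure_mnm_lt (@fdeg 'I_n) wp)) //.
by rewrite leqSpred.
Qed.

Lemma ncdeg_le d p : deg_le d p -> (ncdeg p <= d)%N.
Proof.
move=> pd; rewrite -ltnS; case E : (mmeasure (@fdeg 'I_n) p) => [|k].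
  by rewrite /ncdeg E.
rewrite /ncdeg E /= -E mmeasureE.
by apply/bigmax_leqP_seq => w wp _; apply: pd.
Qed.

Lemma W_surj d w : (fdeg w <= d)%N -> exists i : 'I_(nwords n d), W i = w.
Proof.
rewrite -mem_words => wd.
have := wd; rewrite -index_mem size_words => id.
by exists (Ordinal id); rewrite /W nth_index.
Qed.

Lemma fdegW d (i : 'I_(nwords n d)) : (fdeg (W i) <= d)%N.
Proof. by rewrite -mem_words mem_nth // size_words. Qed.

Lemma W_inj d : injective (@W n d).
Proof.
move=> i j /eqP; rewrite nth_uniq ?size_words ?uniq_words // => /eqP.
exact: val_inj.
Qed.

Lemma trGW_linear d (g : ncpoly R n) : linear (fun G => @trGW R n d G g).
Proof.
move=> a G H; rewrite /trGW scaler_sumr -big_split /=; apply: eq_bigr => i _.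
rewrite scaler_sumr -big_split /=; apply: eq_bigr => j _.
by rewrite !mxE scalerDl scalerA.
Qed.

Lemma trGW0 d (g : ncpoly R n) : trGW (0 : 'M[R]_(nwords n d)) g = 0.
Proof.
rewrite /trGW big1 // => i _; rewrite big1 // => j _.
by rewrite mxE scale0r.
Qed.

Lemma trGWD d (G H : 'M[R]_(nwords n d)) (g : ncpoly R n) :
  trGW (G + H) g = trGW G g + trGW H g.
Proof. by have := trGW_linear g 1 G H; rewrite !scale1r. Qed.

Lemma trGWZ d a (G : 'M[R]_(nwords n d)) (g : ncpoly R n) :
  trGW (a *: G) g = a *: trGW G g.
Proof. by have := trGW_linear g a G 0; rewrite !addr0 trGW0 addr0. Qed.

Lemma trGW_tr d (G : 'M[R]_(nwords n d)) (g : ncpoly R n) :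
  trGW G^T g = ncstar (trGW G (ncstar g)).
Proof.
rewrite /trGW raddf_sum exchange_big; apply: eq_bigr => i _ /=.
rewrite raddf_sum; apply: eq_bigr => j _ /=.
by rewrite linearZ /= ncstar_sandwich mxE.
Qed.

Lemma trGW_deg d (G : 'M[R]_(nwords n d)) (g : ncpoly R n) :
  deg_le (d + ncdeg g + d) (trGW G g).
Proof.
apply: deg_le_sum => i _; apply: deg_le_sum => j _; apply: deg_leZ.
rewrite ncstarU; apply: deg_leM; first apply: deg_leM.
- by move=> w /deg_leU wj; rewrite (leq_trans wj) ?fdegW.
- exact: deg_le_ncdeg.
- by move=> w /deg_leU wj; rewrite (leq_trans wj) // fdeg_wstar fdegW.
Qed.

Lemma trGW_delta d (i j : 'I_(nwords n d)) (g : ncpoly R n) :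
  trGW (delta_mx i j) g = << W j >> * g * ncstar << W i >>.
Proof.
rewrite /trGW (bigD1 i) //= [X in X + _](bigD1 j) //=.
rewrite [X in _ + X + _]big1 => [|j' /negPf j'j].
  rewrite [X in _ + X]big1 => [|i' /negPf i'i].
    by rewrite !addr0 mxE !eqxx scale1r.
  by apply: big1 => j' _; rewrite mxE i'i scale0r.
by rewrite mxE j'j andbF scale0r.
Qed.

(** A word of length at most 2d is v u^* with u and v of length at most d: v
    consists of its first d letters, and u is its remainder, reversed. *)
Lemma gram_word d (c : R) w : (fdeg w <= d.*2)%N ->
  exists B : 'M[R]_(nwords n d), trGW B 1 = << c *g w >>.
Proof.
move=> wd.
have [i iE] : exists i : 'I_(nwords n d), W i = wstar (FMonom (drop d w)).
  by apply: W_surj; rewrite fdeg_wstar fdegE /= size_drop leq_subLR addnn.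
have [j jE] : exists j : 'I_(nwords n d), W j = FMonom (take d w).
  by apply: W_surj; rewrite fdegE /= size_take_min geq_minl.
exists (c *: delta_mx i j); rewrite trGWZ.
rewrite trGW_delta mulr1 ncstarU mulUU mulr1 iE jE wstarK.
apply/malgP => v; rewrite mcoeffZ !mcoeffU mulrnAr mulr1; congr (_ *+ (_ == _)).
by apply/eqP; rewrite fmP fmM /= cat_take_drop.
Qed.

(** Transposing a Gram matrix amounts to applying the involution, so the
    symmetric part of a Gram matrix of p is again a Gram matrix of p. *)
Lemma gram_sym d p : ncsym p -> deg_le d.*2 p ->
  exists2 B : 'M[R]_(nwords n d), B^T = B & trGW B 1 = p.
Proof.
move=> psym pd.
suff [B BE] : exists B : 'M[R]_(nwords n d), trGW B 1 = p.
  exists (2^-1 *: (B + B^T)).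
    by rewrite linearZ linearD /= trmxK addrC.
  rewrite trGWZ trGWD trGW_tr ncstar1 BE psym -mulr2n -scaler_nat scalerA.
  by rewrite mulVf ?scale1r ?pnatr_eq0.
rewrite [p]monalgE big_seq; elim/big_ind: _ => [|q r [B <-] [C <-]|w wp].
- by exists 0; rewrite trGW0.
- by exists (B + C); rewrite trGWD.
- exact/gram_word/pd.
Qed.
End GramMatrices.

(** * The certificate of the ball *)

(** Summation by parts: increasing k by 1 adds s (k+1) to the first sum and
    the telescoping sum s 0 - s (k+1) to the second. *)
Lemma weighted_telescope (R : pzRingType) (V : lmodType R) (s : nat -> V) k :
  \sum_(l < k.+1) s l + \sum_(l < k) (k - l)%:R *: (s l - s l.+1) =
  k.+1%:R *: s 0.
Proof.
elim: k => [|k IHk]; first by rewrite big_ord1 big_ord0 addr0 scale1r.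
have -> : \sum_(l < k.+1) (k.+1 - l)%:R *: (s l - s l.+1) =
    \sum_(l < k) (k - l)%:R *: (s l - s l.+1) + (s 0 - s k.+1).
  have -> : s 0 - s k.+1 = \sum_(l < k.+1) (s l - s l.+1).
    rewrite -(big_mkord xpredT (fun l => s l - s l.+1)).
    rewrite -[LHS]opprB -telescope_sumr // -sumrN.
    by apply: eq_bigr => l _; rewrite opprB.
  rewrite [X in _ = _ + X]big_ord_recr big_ord_recr /=.
  rewrite subSnn scale1r [RHS]addrA.
  congr (_ + _); rewrite -big_split; apply: eq_bigr => l _ /=.
  by rewrite -[X in _ = _ + X]scale1r -scalerDl natr1 subSn // ltnW.
rewrite big_ord_recr /= addrACA IHk [s k.+1 + _]addrC subrK.
by rewrite -[in RHS]natr1 scalerDl scale1r.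
Qed.

Section BallCertificate.
Variables (R : realType) (n : nat).
Implicit Types (p q : ncpoly R n) (w : word n).

Definition conj_sum (l : nat) q : ncpoly R n :=
  \sum_(w <- words_of_length n l) << w >> * q * ncstar << w >>.

Lemma mulUU1 (u v : word n) : << mmul u v >> = << u >> * << v >> :> ncpoly R n.
Proof. by rewrite mulUU mulr1. Qed.

Lemma ncstarX (i : 'I_n) : ncstar (ncX R i) = ncX R i.
Proof.
rewrite ncstarU; congr << _ *g _ >>.
by apply/eqP; rewrite fmP /= fmU.
Qed.

Lemma conj_sum0 q : conj_sum 0 q = q.
Proof. by rewrite /conj_sum big_seq1 mpolyC1E ncstar1 mul1r mulr1. Qed.

Lemma conj_sumS l q :
  conj_sum l.+1 q = \sum_(i < n) ncX R i * conj_sum l q * ncX R i.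
Proof.
rewrite /conj_sum /= big_allpairs_dep big_enum; apply: eq_bigr => i _ /=.
rewrite mulr_sumr mulr_suml; apply: eq_bigr => w _.
have starE : ncstar << mmul (fmu i) w >> = ncstar << w >> * ncX R i.
  rewrite (mulUU1 (fmu i) w); apply: (etrans (ncstarM _ _)).
  by congr (_ * _); apply: ncstarX.
have assoc (S : pzRingType) (a b c d e : S) :
    a * b * c * (d * e) = a * (b * c * d) * e.
  by rewrite !mulrA.
rewrite starE (mulUU1 (fmu i) w); exact: assoc.
Qed.

(** The words of length l+1 are built here by adding letters on the left,
    whereas the squares of the ball polynomial sit on the right of each word;
    induction on l reconciles the two. *)
Lemma conj_sum_ball l :
  conj_sum l (1 - \sum_(i < n) ncX R i ^+ 2) = conj_sum l 1 - conj_sum l.+1 1.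
Proof.
elim: l => [|l IHl].
  have -> : conj_sum 1 1 = \sum_(i < n) ncX R i ^+ 2.
    rewrite conj_sumS; apply: eq_bigr => i _.
    by rewrite (conj_sum0 1) mulr1 expr2.
  by rewrite !conj_sum0.
rewrite conj_sumS IHl; apply/esym; rewrite {1}conj_sumS (conj_sumS l.+1) -sumrB.
have dist (S : pzRingType) (a b c : S) :
    a * b * a - a * c * a = a * (b - c) * a.
  by rewrite mulrBr mulrBl.
by apply: eq_bigr => i _; apply: dist.
Qed.

Lemma trGW_diag d (D : 'rV[R]_(nwords n d)) (g : ncpoly R n) :
  trGW (diag_mx D) g = \sum_i D 0 i *: (<< W i >> * g * ncstar << W i >>).
Proof.
rewrite /trGW; apply: eq_bigr => i _; rewrite (bigD1 i) //= big1 ?addr0.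
  by rewrite mxE eqxx mulr1n.
by move=> j /negPf ji; rewrite mxE eq_sym ji mulr0n scale0r.
Qed.

Lemma trGW_radial d (phi : nat -> R) (g : ncpoly R n) :
  trGW (diag_mx (\row_(i < nwords n d) phi (fdeg (W i)))) g =
  \sum_(l < d.+1) phi l *: conj_sum l g.
Proof.
rewrite trGW_diag.
transitivity (\sum_(w <- words n d)
  phi (fdeg w) *: (<< w >> * g * ncstar << w >>)).
  rewrite (big_nth mone) size_words big_mkord; apply: eq_bigr => i _.
  by rewrite mxE.
rewrite big_flatten big_map -[iota _ _]/(index_iota 0 d.+1) big_mkord.
apply: eq_bigr => l _; rewrite scaler_sumr; apply: eq_big_seq => w.
by rewrite mem_words_of_length => /eqP->.
Qed.

Lemma half_deg_ball : (half_deg (1 - \sum_(i < n) ncX R i ^+ 2) <= 1)%N.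
Proof.
rewrite /half_deg leq_uphalf_double; apply: ncdeg_le => w.
move/(fsubsetP (msuppB_le _ _)); rewrite in_fsetU => /orP[|].
  by rewrite -mpolyC1E => /deg_leU; rewrite fdeg1 leqn0 => /eqP->.
apply: deg_le_sum => i _; rewrite expr2 -mulUU1 => v /deg_leU.
by rewrite fdegM fdegU.
Qed.

(** The bound on d is only k - 1 <= d because the ball polynomial is constant
    when n = 0, and its block then has order k instead of k - 1; the truncated
    subtraction gives weight 0 to the words of length k or more. *)
Lemma ball_certificate k d : (k <= d.+1)%N ->
  trGW (1%:M : 'M[R]_(nwords n k)) 1 +
  trGW (diag_mx (\row_(i < nwords n d) (k - fdeg (W i))%:R))
       (1 - \sum_(i < n) ncX R i ^+ 2) = k.+1%:R%:MP.
Proof.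
move=> kd.
have -> : trGW (1%:M : 'M[R]_(nwords n k)) 1 = \sum_(l < k.+1) conj_sum l 1.
  rewrite -diag_const_mx (_ : const_mx 1 = \row_i 1); last first.
    by apply/rowP => i; rewrite !mxE.
  apply: (etrans (trGW_radial k (fun=> 1) 1)).
  by apply: eq_bigr => l _; rewrite scale1r.
rewrite (trGW_radial d (fun l => (k - l)%:R)).
under [X in _ + X]eq_bigr => l _ do rewrite conj_sum_ball.
rewrite -[RHS]mulr1 mul_malgC -[in RHS](conj_sum0 1).
apply: (etrans _ (weighted_telescope (fun l => conj_sum l 1) k)).
congr (_ + _).
pose t l := conj_sum l 1 - conj_sum l.+1 1.
rewrite -!(big_mkord xpredT (fun l => (k - l)%:R *: t l)).
rewrite (big_cat_nat _ kd) //= [X in _ + X]big_nat.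
rewrite [X in _ + X]big1 ?addr0 // => l /andP[kl _].
by move: kl; rewrite -subn_eq0 => /eqP->; rewrite scale0r.
Qed.
End BallCertificate.

(** * Interior of the quadratic module *)

Section InteriorOfTheQuadraticModule.
Variables (R : realType) (n m : nat).
Implicit Types (g : 'I_m.+1 -> ncpoly R n).

Lemma QintZ g k c p : 0 < c -> Qint g k p -> Qint g k (c *: p).
Proof.
move=> c0 [G [Gpos ->]]; exists (fun i => c *: G i); split=> [i|].
  exact: posdefZ.
by rewrite scaler_sumr; apply: eq_bigr => i _; rewrite trGWZ.
Qed.

Lemma trGW1_sym d (q : ncpoly R n) : ncsym q ->
  ncsym (trGW (1%:M : 'M[R]_(nwords n d)) q).
Proof. by move=> qsym; rewrite /ncsym -[in LHS]qsym -trGW_tr trmx1. Qed.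

(** The index b of the ball polynomial may be 0, namely when n = 0; for this
    reason its diagonal weight D is added on top of the perturbed family
    instead of forming a separate case. *)
Lemma Qint_ball g k (b : 'I_m.+1) :
  (forall i, ncsym (g i)) -> g ord0 = 1 ->
  g b = 1 - \sum_(j < n) ncX R j ^+ 2 ->
  (forall i, i != ord0 -> (half_deg (g i) <= k)%N) ->
  Qint g k (k.+1%:R%:MP).
Proof.
move=> gsym g0 gb gk; pose d i := korder k (g i).
have half_1 : half_deg (1 : ncpoly R n) = 0%N.
  rewrite /half_deg; apply/eqP; rewrite -leqn0 leq_uphalf_double.
  by apply: ncdeg_le => w; rewrite -mpolyC1E => /deg_leU; rewrite fdeg1.
pose p := \sum_(i | i != ord0) trGW (1%:M : 'M[R]_(nwords n (d i))) (g i).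
have psym : ncsym p.
  rewrite /ncsym raddf_sum; apply: eq_bigr => i _.
  exact/trGW1_sym/gsym.
have pdeg : deg_le k.*2 p.
  apply: deg_le_sum => i i0 w /trGW_deg wd; apply: leq_trans wd _.
  have : (ncdeg (g i) <= (half_deg (g i)).*2)%N by rewrite -leq_uphalf_double.
  by have := gk i i0; rewrite /d /korder; lia.
have [B Bsym Bp] := gram_sym psym pdeg.
have [e e0 eB] := posdef_perturb1 Bsym.
pose D i : 'rV[R]_(nwords n (d i)) := \row_s (k - fdeg (W s))%:R.
pose E i : ncpoly R n := if i == b then trGW (diag_mx (D i)) (g i) else 0.
pose target i := (if i == ord0 then trGW (1%:M : 'M[R]_(nwords n k)) 1 - e *: p
                  else e *: trGW (1%:M : 'M[R]_(nwords n (d i))) (g i)) + E i.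
(* The blocks have sizes depending on i, so each of them is first shown to
   exist with its prescribed contribution, and then chosen. *)
have /fin_all_exists[G GP] : forall i, exists G : 'M[R]_(nwords n (d i)),
    posdef G /\ trGW G (g i) = target i.
  move=> i; pose D' := if i == b then D i else 0.
  have D'0 s : 0 <= D' 0 s by rewrite /D'; case: ifP => _; rewrite mxE.
  suff [G [Gpos GE]] : exists G : 'M[R]_(nwords n (d i)), posdef G /\
      trGW G (g i) =
        if i == ord0 then trGW (1%:M : 'M[R]_(nwords n k)) 1 - e *: p
        else e *: trGW (1%:M : 'M[R]_(nwords n (d i))) (g i).
    exists (G + diag_mx D'); split; first exact: posdefD_diag.
    rewrite trGWD GE; congr (_ + _); rewrite /D' /E; case: eqP => // _.
    by rewrite linear0 trGW0.
  case: eqVneq => [->|i0].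
    rewrite /d g0 /korder half_1 subn0; exists (1%:M - e *: B); split=> //.
    by rewrite -scaleNr trGWD trGWZ Bp scaleNr.
  by exists (e *: 1%:M); split; rewrite ?trGWZ //; apply/posdefZ/posdef1.
exists G; split=> [i|]; first by have [] := GP i.
rewrite (eq_bigr target) => [|i _]; last by have [] := GP i.
have kd : (k <= (d b).+1)%N.
  by rewrite /d /korder gb; have := half_deg_ball R n; lia.
rewrite -(ball_certificate R n kd) -gb big_split /=; congr (_ + _); last first.
  by rewrite -big_mkcond big_pred1_eq.
rewrite (bigD1 ord0) //= /p scaler_sumr -[LHS]addr0 -addrA; congr (_ + _).
apply/esym/eqP; rewrite addrC subr_eq0; apply/eqP.
by apply: eq_bigr => i /negPf->.
Qed.

End InteriorOfTheQuadraticModule.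

(** * Duality with moment matrices *)

Section TraceDuality.
Variables (R : realType) (n : nat).
Implicit Types (p q : ncpoly R n) (w : word n) (y : word n -> R).

Lemma rieszU y (c : R) w : riesz y << c *g w >> = c * y w.
Proof. exact: (@mmapU _ _ _ idfun). Qed.

Lemma riesz_sum y (I : Type) (r : seq I) (P : pred I) (F : I -> ncpoly R n) :
  riesz y (\sum_(i <- r | P i) F i) = \sum_(i <- r | P i) riesz y (F i).
Proof. exact: (raddf_sum (mmap idfun y)). Qed.

Lemma rieszZ y c p : riesz y (c *: p) = c * riesz y p.
Proof.
have [->|c0] := eqVneq c 0.
  by rewrite scale0r mul0r /riesz msupp0 big_seq_fset0.
rewrite /riesz msuppZ (negPf c0) mulr_sumr; apply: eq_bigr => w _.
by rewrite mcoeffZ mulrA.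
Qed.

Lemma riesz_trGW y d (G : 'M[R]_(nwords n d)) (g : ncpoly R n) :
  riesz y (trGW G g) =
  \sum_i \sum_j G i j * riesz y (<< W j >> * g * ncstar << W i >>).
Proof.
rewrite riesz_sum; apply: eq_bigr => i _; rewrite riesz_sum.
by apply: eq_bigr => j _; rewrite rieszZ.
Qed.

Lemma W_reversal d : exists2 r : 'I_(nwords n d) -> 'I_(nwords n d),
  involutive r & forall i, W (r i) = wstar (W i).
Proof.
have /fin_all_exists[r rE] : forall i : 'I_(nwords n d),
    exists j : 'I_(nwords n d), W j = wstar (W i).
  by move=> i; apply: W_surj; rewrite fdeg_wstar fdegW.
by exists r => // i; apply: W_inj; rewrite !rE wstarK.
Qed.

Lemma posdef_reindex d (G : 'M[R]_d) (r : 'I_d -> 'I_d) :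
  involutive r -> posdef G -> posdef (mxsub r r G).
Proof.
move=> rK [Gsym Gpos]; split=> [|x x0].
  by rewrite trmx_mxsub Gsym.
have rx0 : rowsub r x != 0.
  apply: contraNneq x0 => rx; apply/eqP/matrixP => i j; rewrite mxE.
  by move/matrixP/(_ (r i) j): rx; rewrite !mxE rK.
suff -> : x^T *m mxsub r r G *m x = (rowsub r x)^T *m G *m rowsub r x.
  exact: Gpos.
apply/matrixP => i j; rewrite !mxE (reindex_inj (inv_inj rK)).
apply: eq_bigr => s _; rewrite !mxE; congr (_ * _).
rewrite (reindex_inj (inv_inj rK)).
by apply: eq_bigr => t _; rewrite !mxE !rK.
Qed.

(** The moment matrix has entries L(u^* g v), whereas Tr (G W g W^* ) is made of
    the terms v g u^*: the two match after reversing the words that index G. *)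
Lemma trace_duality d (G : 'M[R]_(nwords n d)) (g : ncpoly R n) : posdef G ->
  exists2 P : 'M[R]_(nwords n d), posdef P &
    forall y, \tr (P^T *m locmx d g y *m P) = riesz y (trGW G g).
Proof.
move=> Gpos; have [r rK rW] := W_reversal d.
have [P Ppos PP] := posdef_sqrt (posdef_reindex rK Gpos).
exists P => // y; have [Psym _] := Ppos.
rewrite mxtrace_mulC mulmxA Psym PP riesz_trGW /mxtrace.
rewrite [RHS](reindex_inj (inv_inj rK)); apply: eq_bigr => i _.
rewrite mxE [RHS](reindex_inj (inv_inj rK)); apply: eq_bigr => j _.
by rewrite !mxE !rW !ncstarU wstarK.
Qed.

End TraceDuality.

Lemma Qint_trace (R : realType) (n m : nat) (g : 'I_m.+1 -> ncpoly R n) k p :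
  Qint g k p ->
  exists P : 'M[R]_(\sum_(i < m.+1) nwords n (korder k (g i))),
    [/\ Sblock P, posdef P &
      forall y, \tr (P^T *m Dmx g k y *m P) = riesz y p].
Proof.
move=> [G [Gpos ->]].
have /fin_all_exists2[P Ppos PE] := fun i => trace_duality (g i) (Gpos i).
exists (\mxdiag_i P i); split=> [||y].
- by exists P; split=> // i; have [] := Ppos i.
- exact: posdef_mxdiag.
rewrite tr_mxdiag /Dmx !mul_mxdiag mxtrace_mxdiag riesz_sum.
by apply: eq_bigr => i _; apply: PE.
Qed.

Theorem theorem3p6 (R : realType) (n m l : nat) (f : ncpoly R n)
    (g : 'I_m.+1 -> ncpoly R n) (h : 'I_l -> ncpoly R n)
    (fsym : ncsym f) (gsym : forall i, ncsym (g i))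
    (hsym : forall j, ncsym (h j)) (g0 : g ord0 = 1)
    (gball : exists i, g i = 1 - \sum_(j < n) ncX R j ^+ 2) :
  (forall k : nat, (kmin f g h <= k)%N ->
    forall a : R, 0 < a -> Qint g k (a%:MP)) /\
  CTP f g h.
Proof.
have Qconst k : (kmin f g h <= k)%N -> forall a : R, 0 < a -> Qint g k (a%:MP).
  rewrite /kmin !geq_max => /and3P[_ /bigmax_leqP gk _] a a0.
  have k1 : 0 < k.+1%:R :> R by rewrite ltr0n.
  have [b gb] := gball; rewrite -[a](divfK (lt0r_neq0 k1)) mpolyCM mul_malgC.
  apply: QintZ; first by rewrite divr_gt0.
  by apply: (Qint_ball gsym g0 gb) => i i0; apply: gk; rewrite lt0n.
split=> // k /Qconst/(_ 1 ltr01)/Qint_trace[P [Pblock Ppos PE]].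
exists 1, P; split=> // y _ _ y1.
by rewrite PE rieszU y1 mulr1.
Qed.
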